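(* Let $f$ be a consensus function on the $n$-cube $Q_n$. Then $f = Med$ if and only if $f$ satisfies the Translation axiom (T) and, for any profile $\pi=(x_1,\dots,x_k)$ with $x_j=(x_1^j,\dots,x_n^j)\in\{0,1\}^n$ for $j=1,\dots,k$, $$\mathbf{0}\in f(\pi)\ \text{ if and only if }\ \sum_{j=1}^k x_i^j\le\frac{k}{2}\ \text{ for all } i\in\{1,\dots,n\}.$$
   Context: $Q_n=(X,E)$ is the $n$-dimensional hypercube graph with vertex set $X=\{0,1\}^n$ and distance $d(u,v)=\sum_{i=1}^n|u_i-v_i|$ (Hamming distance). A profile is a finite sequence $\pi=(x_1,\dots,x_k)$ of vertices of $X$ of any length $k\ge 1$; $X^*=\bigcup_{k\ge1}X^k$ is the set of all profiles. A consensus function on $Q_n$ is a map $f:X^*\to 2^X\setminus\{\emptyset\}$. For $u,v\in X$, $u\oplus v$ denotes coordinatewise addition modulo 2, and $\pi\oplus v=(x_1\oplus v,\dots,x_k\oplus v)$. $\mathbf{0}=(0,\dots,0)$. The median function $Med$ is defined by $Med(\pi)=\{x\in X: S_\pi(x)\text{ is minimum}\}$, where $S_\pi(x)=\sum_{i=1}^k d(x,x_i)$ and the minimum is over all $x\in X$. Translation (T): for every profile $\pi$ and all vertices $u,v\in X$, $u\in f(\pi)$ implies $u\oplus v\in f(\pi\oplus v)$. *)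

(* Defs.v *)
From HB Require Import structures.
From mathcomp Require Import all_boot all_order all_algebra.

Set Implicit Arguments.
Unset Strict Implicit.
Unset Printing Implicit Defensive.

(* Vertices of the n-cube Q_n; a coordinate is a bool, read as 0 or 1 through
   the coercion from bool to nat. *)
Definition cube (n : nat) := {ffun 'I_n -> bool}.

Definition cube0 (n : nat) : cube n := [ffun=> false].

(* On bool, the exclusive or (+) is addition modulo 2. *)
Definition cadd (n : nat) (u v : cube n) : cube n := [ffun i => u i (+) v i].

(* `|a - b|%N is the absolute value of the difference taken in int, not a
   truncated subtraction. *)
Definition hdist (n : nat) (u v : cube n) : nat :=
  (\sum_(i < n) `|u i - v i|)%N.

Record profile (n : nat) := Profile {
  profile_seq :> seq (cube n);
  profile_gt0 : 0 < size profile_seq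
}.

HB.instance Definition _ (n : nat) := [isSub for @profile_seq n].

Lemma translate_subproof (n : nat) (p : profile n) (v : cube n) :
  0 < size [seq cadd x v | x <- p].
Proof. by rewrite size_map profile_gt0. Qed.

Definition translate (n : nat) (p : profile n) (v : cube n) : profile n :=
  Profile (translate_subproof p v).

Definition consensus (n : nat) (f : profile n -> {set cube n}) : Prop :=
  forall p : profile n, f p != set0.

(* The sum runs over the profile as a sequence, so with multiplicity. *)
Definition remoteness (n : nat) (p : profile n) (x : cube n) : nat :=
  \sum_(y <- p) hdist x y.

Definition Med (n : nat) (p : profile n) : {set cube n} :=
  [set x | [forall y, remoteness p x <= remoteness p y]].

Definition translation (n : nat) (f : profile n -> {set cube n}) : Prop :=
  forall (p : profile n) (u v : cube n),
    u \in f p -> cadd u v \in f (translate p v).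

(* Main.v *)
Require Import Defs.
From mathcomp Require Import all_boot all_order all_algebra.

(** Interchanging the sums over the coordinates and over the profile writes
    the remoteness of [x] as a sum, over the coordinates [i], of the number of
    members of the profile that disagree with [x] at [i] ([remotenessE]).  The
    coordinates of [x] can be chosen independently, so [x] minimizes the sum
    iff it minimizes every term, that is, iff each [x i] is a majority value
    ([mem_Med]).  For [x = 0] this is the condition on the column sums
    ([cube0_mem_Med]).  Distances, hence medians, are invariant under
    translation ([Med_translation]).

    Conversely, translations are involutions, so for a function [f] satisfying
    (T), a vertex [u] lies in [f p] iff [0] lies in [f] of the profile [p]
    translated by [u] ([translation_mem]).  Such a function is therefore
    determined by the profiles [p] with [0] in [f p], and two such functions
    with the same profiles of this kind, such as [f] and [Med], are equal. *)

Import Order.TTheory GRing.Theory Num.Theory.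

Section Cube.

Variable n : nat.
Implicit Types (p : profile n) (u v x y : cube n).
Implicit Types (f : profile n -> {set cube n}).

Lemma hdistE x y : hdist x y = \sum_(i < n) (x i (+) y i).
Proof. by apply: eq_bigr => i _; case: (x i); case: (y i). Qed.

Lemma caddK v : involutive (fun u => cadd u v).
Proof. by move=> u; apply/ffunP => i; rewrite !ffunE addbK. Qed.

Lemma caddv v : cadd v v = cube0 n.
Proof. by apply/ffunP => i; rewrite !ffunE addbb. Qed.

Lemma cadd0 v : cadd (cube0 n) v = v.
Proof. by apply/ffunP => i; rewrite !ffunE. Qed.

Lemma hdist_cadd x y v : hdist (cadd x v) (cadd y v) = hdist x y.
Proof.
rewrite !hdistE; apply: eq_bigr => i _; rewrite !ffunE.
by case: (x i); case: (y i); case: (v i).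
Qed.

Lemma translateK v : involutive (fun p => translate p v).
Proof.
move=> p; apply: val_inj => /=.
by rewrite -map_comp (eq_map (caddK v)) map_id.
Qed.

Lemma remoteness_translate p x v :
  remoteness (translate p v) (cadd x v) = remoteness p x.
Proof.
by rewrite /remoteness big_map; apply: eq_bigr => y _; rewrite hdist_cadd.
Qed.

Lemma Med_translation : translation (@Med n).
Proof.
move=> p u v; rewrite !inE => /forallP min_u; apply/forallP => y.
by rewrite -[y in leqRHS](caddK v) !remoteness_translate.
Qed.

Lemma translation_mem f p u :
  translation f -> (u \in f p) = (cube0 n \in f (translate p u)).
Proof.
move=> fT; apply/idP/idP => [/(fT _ _ u)|/(fT _ _ u)]; first by rewrite caddv.
by rewrite cadd0 translateK.
Qed.

Definition disagreement p (i : 'I_n) (b : bool) : nat :=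
  \sum_(y <- p) (b (+) y i).

Lemma remotenessE p x : remoteness p x = \sum_(i < n) disagreement p i (x i).
Proof. by rewrite exchange_big; apply: eq_bigr => y _; rewrite hdistE. Qed.

Lemma disagreementD p i b :
  disagreement p i b + disagreement p i (~~ b) = size p.
Proof.
rewrite -big_split -sum1_size; apply: eq_bigr => y _.
by case: b; case: (y i).
Qed.

(** If [x] is a median, then comparing [x] with its neighbour along the
    coordinate [i] compares only the terms at [i] of the two sums; and a
    vertex for which every term is minimum has minimum remoteness. *)
Lemma mem_Med p x :
  reflect (forall i, disagreement p i (x i) <= disagreement p i (~~ x i))
          (x \in Med p).
Proof.
rewrite inE; apply: (iffP forallP) => [min_x i|maj_x y].
- pose y : cube n := [ffun j => x j (+) (j == i)].
  have := min_x y; rewrite !remotenessE (bigD1 i) //= [in leqRHS](bigD1 i) //=.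
  have -> : \sum_(j < n | j != i) disagreement p j (y j)
          = \sum_(j < n | j != i) disagreement p j (x j).
    by apply: eq_bigr => j /negPf nji; rewrite ffunE nji addbF.
  by rewrite leq_add2r ffunE eqxx addbT.
- rewrite !remotenessE; apply: leq_sum => i _.
  by have := maj_x i; case: (x i); case: (y i).
Qed.

Lemma ler_half_rat (c k : nat) : (c%:R <= k%:R / 2%:R :> rat)%R = (c.*2 <= k).
Proof. by rewrite ler_pdivlMr ?ltr0n // -natrM ler_nat muln2. Qed.

Lemma cube0_mem_Med p :
  cube0 n \in Med p <->
  (forall i : 'I_n,
     ((\sum_(x <- p) (x i : nat))%N%:R <= (size p)%:R / 2%:R :> rat)%R).
Proof.
(* The column sum at [i] is the number of members of [p] disagreeing with [0]
   there, and the others disagree with [1]. *)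
have colE i : (disagreement p i (cube0 n i)
                 <= disagreement p i (~~ cube0 n i))
  = ((\sum_(x <- p) (x i : nat))%N%:R <= (size p)%:R / 2%:R :> rat)%R.
  by rewrite ler_half_rat -(disagreementD p i false) -addnn leq_add2l ffunE.
split=> [/mem_Med maj0 i|maj0]; first by rewrite -colE.
by apply/mem_Med => i; rewrite colE.
Qed.

End Cube.

Theorem corollary2 (n : nat) (f : profile n -> {set cube n})
    (hf : consensus f) :
  f =1 @Med n <->
  translation f /\
  (forall p : profile n,
     cube0 n \in f p <->
     (forall i : 'I_n,
        ((\sum_(x <- p) (x i : nat))%N%:R <= (size p)%:R / 2%:R :> rat)%R)).
Proof.
split=> [fMed|[fT f0] p].
- split=> [p u v|p]; last by rewrite fMed; exact: cube0_mem_Med.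
  by rewrite !fMed; exact: Med_translation.
- apply/setP => u; rewrite (translation_mem _ _ _ _ fT).
  rewrite (translation_mem _ _ _ _ (Med_translation n)).
  by apply/idP/idP => [/f0/cube0_mem_Med|/cube0_mem_Med/f0].
Qed.
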